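(* For every graph $G$, $$\alpha(G)\le\min_{(M,x)\in\mathcal{M}(G)}F(M,x)=\vartheta(G),$$ with equality $\alpha(G)=\vartheta(G)$ if and only if there exist $(M,x)\in\mathcal{M}(G)$ and an independent set $C$ of $G$ such that $M[C]$ is diagonal and, with $c=\max_{u\in V(G)}\frac{(M)_{uu}}{x_u^2}$, one has $\frac{(M)_{vv}}{x_v^2}=c$ for all $v\in C$ and $c\,x_v=\sum_{u\in C}(M)_{vu}x_u^{-1}$ for all $v\notin C$.
   Context: $\alpha(G)$ is the independence number of the $n$-vertex graph $G$. $M^\#$ is the group inverse of a square matrix $M$ (unique $X$ with $MXM=M$, $XMX=X$, $MX=XM$; for PSD $M=U\mathrm{diag}(\lambda_i)U^\top$, $M^\#=U\mathrm{diag}(\lambda_i^+)U^\top$ with $\lambda^+=\lambda^{-1}$ for $\lambda>0$, $0^+=0$). $R(M)$ is the column space, $M[C]$ the principal submatrix indexed by $C$; a vector is total nonzero if all entries are nonzero. $\mathcal{M}(G)$ is the set of pairs $(M,x)$ with $M$ a real positive semidefinite matrix indexed by $V(G)$ such that $(M)_{ij}=0$ for distinct nonadjacent $i,j$, and $x\in R(M)$ a total nonzero real vector. $F(M,x)=x^\top M^\#x\max_{u\in V(G)}\frac{(M)_{uu}}{x_u^2}$. The Lovász theta function: an orthonormal representation of $G$ is a family of real unit vectors $u_1,\dots,u_n$ with $u_i^\top u_j=0$ whenever $i,j$ are distinct nonadjacent vertices; its value is $\min_c\max_i (c^\top u_i)^{-2}$ over unit vectors $c$; $\vartheta(G)$ is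 the minimum value over all orthonormal representations (equivalently, the minimum largest eigenvalue of a real symmetric matrix $A$ indexed by $V(G)$ with $(A)_{ij}=1$ when $i=j$ or $i,j$ nonadjacent). *)

(* Defs.v *)
From mathcomp Require Import all_boot all_order all_algebra.
From mathcomp Require Import boolp classical_sets reals.

Set Implicit Arguments.
Unset Strict Implicit.
Unset Printing Implicit Defensive.

Import Order.TTheory GRing.Theory Num.Theory.

Local Open Scope classical_set_scope.
Local Open Scope ring_scope.

(* A simple graph on the vertex set 'I_n is given by a symmetric and
   irreflexive adjacency relation e : rel 'I_n. *)

Section Graph.
Context (n : nat) (e : rel 'I_n).

Definition independent (C : {set 'I_n}) : bool :=
  [forall u in C, forall v in C, ~~ e u v].

Definition independence_number : nat :=
  \max_(C : {set 'I_n} | independent C) #|C|.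

End Graph.

Definition is_minimum (R : realType) (A : set R) (m : R) : Prop :=
  A m /\ lbound A m.

(* The minimum of A, and 0 if A has no least element. *)
Definition minimum (R : realType) (A : set R) : R := xget 0 (is_minimum A).

Section MatrixNotions.
Context (R : realType) (n : nat).
Implicit Types (M X : 'M[R]_n) (x : 'cV[R]_n).

Definition psd M : Prop :=
  M^T = M /\ forall y : 'cV[R]_n, 0 <= (y^T *m M *m y) 0 0.

Definition is_group_inverse M X : Prop :=
  [/\ M *m X *m M = M, X *m M *m X = X & M *m X = X *m M].

Lemma is_group_inverse_uniq M X Y :
  is_group_inverse M X -> is_group_inverse M Y -> X = Y.
Proof.
move=> [MXM XMX cX] [MYM YMY cY].
have eXY : M *m X = M *m Y.
  transitivity (X *m M *m (M *m Y)); last by rewrite -cX mulmxA MXM.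
  by rewrite cX cY -mulmxA (mulmxA M) MYM.
transitivity (Y *m M *m X); first by rewrite -cY -eXY cX XMX.
by rewrite -mulmxA eXY mulmxA YMY.
Qed.

(* The group inverse of M, and 0 if M has none. *)
Definition group_inverse M : 'M[R]_n := xget 0 (is_group_inverse M).

Definition in_column_space M x : Prop := exists y : 'cV[R]_n, x = M *m y.

Definition total_nonzero x : Prop := forall u, x u 0 != 0.

Definition principal_submx M (C : {set 'I_n}) : 'M[R]_#|C| :=
  mxsub (fun i => enum_val i) (fun i => enum_val i) M.

(* When M is psd all the terms are nonnegative, so that the default value 0 of
   the iterated maximum is harmless. *)
Definition max_ratio M x : R :=
  \big[Num.max/0]_(u < n) (M u u / x u 0 ^+ 2).

Definition Fval M x : R :=
  (x^T *m group_inverse M *m x) 0 0 * max_ratio M x.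

Definition graph_pairs (e : rel 'I_n) : set ('M[R]_n * 'cV[R]_n) :=
  [set p | [/\ psd p.1,
               forall i j, i != j -> ~~ e i j -> p.1 i j = 0,
               in_column_space p.1 p.2
             & total_nonzero p.2]].

End MatrixNotions.

Section LovaszTheta.
Context (R : realType) (n : nat) (e : rel 'I_n).

Definition dotp d (u v : 'cV[R]_d) : R := (u^T *m v) 0 0.

Definition unit_vector d (u : 'cV[R]_d) : Prop := dotp u u = 1.

Definition orthonormal_rep d (U : 'I_n -> 'cV[R]_d) : Prop :=
  (forall i, unit_vector (U i)) /\
  (forall i j, i != j -> ~~ e i j -> dotp (U i) (U j) = 0).

(* Unit vectors c orthogonal to some U i would give an infinite maximum; they
   are excluded explicitly because 0^-1 = 0 in R. *)
Definition rep_value d (U : 'I_n -> 'cV[R]_d) : R :=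
  minimum [set m | exists c : 'cV[R]_d,
    [/\ unit_vector c, forall i, dotp c (U i) != 0
      & m = \big[Num.max/0]_(i < n) (dotp c (U i)) ^- 2]].

(* The dimension d of the representation is unrestricted. *)
Definition lovasz_theta : R :=
  minimum [set t | exists (d : nat) (U : 'I_n -> 'cV[R]_d),
    orthonormal_rep U /\ t = rep_value U].

End LovaszTheta.

(* Main.v *)
Require Import Defs.
From mathcomp Require Import all_boot all_order all_algebra ring lra.
From mathcomp Require Import boolp classical_sets reals.
From mathcomp Require Import topology normedtype derive.

Set Implicit Arguments.
Unset Strict Implicit.
Unset Printing Implicit Defensive.

Import numFieldNormedType.Exports.
Import Order.TTheory GRing.Theory Num.Theory.

Local Open Scope classical_set_scope.
Local Open Scope ring_scope.

(* A pair (M, x) and a representation U with handle c correspond to each other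
   through M = B^T B and x = M y, with c = B y and U_i the i-th column of B, up
   to normalization; conversely M is the Gram matrix of U and x_i = c^T U_i,
   and then F(M, x) is at most the value of (U, c) because projecting c on the
   span of U shortens it.  Both minima in the definition of theta are attained
   by compactness; for the outer one, Gram matrices of (c, U_1, ..., U_n) reduce
   the dimension to n + 1.

   For C independent and K = max_u M_uu / x_u^2, let w_u = 1 / x_u on C and 0
   elsewhere.  Then w^T M w is the sum of M_uu / x_u^2 over C, hence at most
   K |C|, and evaluating the form M at y - w / K gives |C| <= F(M, x).  Equality
   forces M_uu / x_u^2 = K on C and M (y - w / K) = 0, i.e. K x = M w. *)

(** * Inner products of column vectors *)

Section DotProduct.
Context (R : realType).

Lemma dotpE d (u v : 'cV[R]_d) : dotp u v = \sum_i u i 0 * v i 0.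
Proof. by rewrite /dotp mxE; apply: eq_bigr => i _; rewrite mxE. Qed.

Lemma dotpC d (u v : 'cV[R]_d) : dotp u v = dotp v u.
Proof. by rewrite !dotpE; apply: eq_bigr => i _; rewrite mulrC. Qed.

Lemma dotpDr d (u v w : 'cV[R]_d) : dotp u (v + w) = dotp u v + dotp u w.
Proof. by rewrite /dotp mulmxDr mxE. Qed.

Lemma dotpBr d (u v w : 'cV[R]_d) : dotp u (v - w) = dotp u v - dotp u w.
Proof. by rewrite /dotp mulmxBr !mxE. Qed.

Lemma dotpBl d (u v w : 'cV[R]_d) : dotp (v - w) u = dotp v u - dotp w u.
Proof. by rewrite dotpC dotpBr !(dotpC u). Qed.

Lemma dotpZr d a (u v : 'cV[R]_d) : dotp u (a *: v) = a * dotp u v.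
Proof. by rewrite /dotp -scalemxAr mxE. Qed.

Lemma dotpZl d a (u v : 'cV[R]_d) : dotp (a *: u) v = a * dotp u v.
Proof. by rewrite dotpC dotpZr dotpC. Qed.

Lemma dotp_mulmx d k (A : 'M[R]_(d, k)) (u : 'cV_d) (v : 'cV_k) :
  dotp u (A *m v) = dotp (A^T *m u) v.
Proof. by rewrite /dotp trmx_mul trmxK mulmxA. Qed.

Lemma dotp_ge0 d (u : 'cV[R]_d) : 0 <= dotp u u.
Proof. by rewrite dotpE sumr_ge0 // => i _; rewrite -expr2 sqr_ge0. Qed.

Lemma dotp_eq0 d (u : 'cV[R]_d) : dotp u u = 0 -> u = 0.
Proof.
rewrite dotpE => /eqP; rewrite psumr_eq0; last first.
  by move=> i _; rewrite -expr2 sqr_ge0.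
move=> /allP u0; apply/matrixP => i j; rewrite ord1 mxE.
by have := u0 i (mem_index_enum _); rewrite -expr2 sqrf_eq0 => /eqP.
Qed.

Lemma unit_vector_coord d (u : 'cV[R]_d) i : unit_vector u -> `|u i 0| <= 1.
Proof.
rewrite /unit_vector dotpE (bigD1 i) //= -expr2 => u1.
have : 0 <= \sum_(j | j != i) u j 0 * u j 0.
  by apply: sumr_ge0 => j _; rewrite -expr2 sqr_ge0.
rewrite -(@expr_le1 _ 2) // real_normK ?num_real //; lra.
Qed.

(** Cauchy-Schwarz for unit vectors, read off the squared norm of the component of [u] orthogonal to
    [v]. *)
Lemma dotp_unit_sqr_le1 d (u v : 'cV[R]_d) :
  unit_vector u -> unit_vector v -> dotp u v ^+ 2 <= 1.
Proof.
move=> u1 v1; have := dotp_ge0 (u - dotp u v *: v).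
rewrite dotpBl !dotpBr !dotpZl !dotpZr u1 v1 (dotpC v u) => h.
nra.
Qed.

End DotProduct.

(** * Positive semidefinite matrices: Gram factorization and group inverse *)

Section Psd.
Context (R : realType).

Lemma psd_dotp n (M : 'M[R]_n) (y : 'cV_n) : psd M -> 0 <= dotp y (M *m y).
Proof. by case=> _ /(_ y); rewrite /dotp mulmxA. Qed.

Lemma gram_psd d n (W : 'M[R]_(d, n)) : psd (W^T *m W).
Proof.
split=> [|y]; first by rewrite trmx_mul trmxK.
by rewrite -!mulmxA mulmxA -trmx_mul dotp_ge0.
Qed.

(* Completing the square with respect to the first coordinate; when the pivot
   vanishes, so does the rest of its row, and the formulas below stay valid
   with [0^-1 = 0]. *)
Lemma psd_gram n (M : 'M[R]_n) : psd M -> exists B : 'M[R]_n, M = B^T *m B.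
Proof.
elim: n M => [|n IHn] M psdM; first by exists 0; apply/matrixP => -[].
rewrite -[n.+1]/(1 + n)%N in M psdM *.
set a := M 0 0; pose v : 'rV_n := ursubmx M; pose N : 'M_n := drsubmx M.
have MT : M^T = M by case: psdM.
have Mblock : M = block_mx a%:M v v^T N.
  rewrite -[LHS]submxK; congr block_mx.
    by rewrite [LHS]mx11_scalar; congr _%:M; rewrite !mxE; congr (M _ _);
       apply/val_inj.
  by rewrite /v trmx_ursub MT.
have NT : N^T = N by rewrite /N trmx_drsub MT.
have quad (t : R) (w : 'cV_n) :
    0 <= a * t ^+ 2 + 2 * t * (v *m w) 0 0 + dotp w (N *m w).
  have := psd_dotp (col_mx t%:M w : 'cV_(1 + n)) psdM.
  rewrite {1}Mblock mul_block_col /dotp tr_col_mx mul_row_col.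
  rewrite [X in 0 <= X -> _]mxE -!/(dotp _ _) 2!dotpDr (dotp_mulmx _ w) trmxK.
  rewrite !dotpE !big_ord1 !mxE !big_ord1 !mxE /= !mulr1n.
  congr (0 <= _); ring.
have a_ge0 : 0 <= a by have := quad 1 0; rewrite mulmx0 /dotp !mulmx0 !mxE; lra.
have v0 : a = 0 -> v = 0.
  move=> a0; apply: trmx_inj; rewrite trmx0; apply: dotp_eq0; apply/eqP.
  set s := dotp _ _; apply/eqP; pose b := dotp v^T (N *m v^T).
  (* With zero pivot the form is affine in [t]; if [s] were nonzero, this [t] would give it the
     value [-1]. *)
  have := quad (- (b + 1) / (2 * s)) v^T; rewrite a0.
  have -> : (v *m v^T) 0 0 = s by rewrite /s /dotp trmxK.
  have [->//|s0] := eqVneq s 0.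
  rewrite -/b; have -> : 2 * (- (b + 1) / (2 * s)) * s = - (b + 1) by field.
  lra.
have psdS : psd (N - a^-1 *: (v^T *m v)).
  split=> [|w]; first by rewrite linearB linearZ /= NT trmx_mul trmxK.
  rewrite -mulmxA -/(dotp _ _) mulmxBl dotpBr -scalemxAl dotpZr -mulmxA.
  rewrite (dotp_mulmx v^T w) trmxK [dotp (v *m w) _]dotpE big_ord1.
  have [a0|a0] := eqVneq a 0.
    by have := quad 0 w; rewrite v0 // mul0mx !mxE; lra.
  (* This [t] minimizes the quadratic in [t], and the minimum is the form of the Schur complement at
     [w]. *)
  have := quad (- (v *m w) 0 0 / a) w.
  set z := (v *m w) 0 0 => h; apply: le_trans h _.
  rewrite le_eqVlt; apply/orP; left; apply/eqP; field.
  exact: a0.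
have [B' SE] := IHn _ psdS.
pose s := Num.sqrt a; have s2 : s * s = a by rewrite -expr2 sqr_sqrtr.
have ssV : (s * s^-1) *: v = v.
  have [a0|a0] := eqVneq a 0; first by rewrite v0 // scaler0.
  by rewrite divff ?scale1r // gt_eqF // sqrtr_gt0 lt_def a0.
exists (block_mx s%:M (s^-1 *: v) 0 B').
rewrite Mblock tr_block_mx mulmx_block !tr_scalar_mx trmx0 !mul0mx !mulmx0.
rewrite !addr0 -scalar_mxM s2 mul_scalar_mx scalerA ssV mul_mx_scalar.
have vTZ b : (b *: v)^T = b *: v^T by rewrite linearZ.
rewrite !vTZ scalerA -[(s / s) *: _]vTZ ssV -scalemxAl -scalemxAr scalerA.
by rewrite -invfM s2 -SE addrC subrK.
Qed.

(** Solvability of least squares: a vector in the range of [W^T] killed by [W] has norm zero, so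
    [W^T *m W] has the rank, hence the row space, of [W]. With [C] the identity this leads to the
    group inverse, and with [C] a handle it projects the handle on the span of a representation. *)
Lemma normal_equation d n k (W : 'M[R]_(d, n)) (C : 'M_(d, k)) :
  exists Y : 'M_(n, k), W^T *m C = W^T *m W *m Y.
Proof.
have rkW : \rank (W^T *m W) = \rank W.
  rewrite -(mxrank_tr W) -(mxrank_mul_ker W^T W).
  suff -> : (W^T :&: kermx W)%MS = 0 by rewrite mxrank0 addn0.
  apply/eqP/rowV0P => v; rewrite sub_capmx => /andP[/submxP[u ->]].
  move=> /sub_kermxP uWW0; apply: trmx_inj; rewrite trmx0; apply: dotp_eq0.
  by rewrite /dotp trmxK trmx_mul trmxK mulmxA uWW0 mul0mx mxE.
have WWT : (W <= W^T *m W)%MS.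
  by rewrite -(geq_leqif (mxrank_leqif_sup (submxMl W^T W))) rkW.
have /submxP[D CE] := submx_trans (submxMl C^T W) WWT.
exists D^T; apply: trmx_inj; rewrite trmx_mul trmxK CE.
by rewrite !trmx_mul !trmxK.
Qed.

(** The normal equation gives [Y] with [M = M *m M *m Y]. Then [E = M *m Y] is the orthogonal
    projection on the column space of [M], and [X = E *m Y] satisfies [M *m X = X *m M = E]. *)
Lemma psd_group_inverse n (M : 'M[R]_n) : psd M ->
  is_group_inverse M (group_inverse M).
Proof.
move=> [MT _].
have [Y] := normal_equation M (1%:M : 'M_n); rewrite MT mulmx1 => MMY.
pose E := M *m Y.
have YMM : Y^T *m M *m M = M.
  by apply: trmx_inj; rewrite !trmx_mul trmxK MT mulmxA -MMY.
have EE : Y^T *m M = E by rewrite /E -[in RHS]YMM -!mulmxA (mulmxA M) -MMY.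
apply: (@xgetPex _ 0 (is_group_inverse M)); exists (E *m Y).
have ME : M *m E = M by rewrite /E mulmxA -MMY.
have EM : E *m M = M by rewrite -EE.
have MX : M *m (E *m Y) = E by rewrite mulmxA ME.
have XM : E *m Y *m M = E.
  by rewrite -{1}EE -(mulmxA Y^T) -/E -mulmxA EM EE.
have EEE : E *m E = E by rewrite {2}/E mulmxA EM.
by split; rewrite ?MX ?XM // mulmxA EEE.
Qed.

Lemma psd_inverse_quad n (M : 'M[R]_n) (y : 'cV_n) : psd M ->
  ((M *m y)^T *m group_inverse M *m (M *m y)) 0 0 = dotp y (M *m y).
Proof.
move=> psdM; have [MXM _ _] := psd_group_inverse psdM.
have [MT _] := psdM.
rewrite trmx_mul MT -(mulmxA y^T) (mulmxA _ M y) -(mulmxA y^T) MXM.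
by rewrite -mulmxA.
Qed.

End Psd.

(** * Passage between pairs [(M, x)] and representations with a handle *)

Section GraphPairs.
Context (R : realType) (n : nat) (e : rel 'I_n).
Implicit Types (M : 'M[R]_n) (x : 'cV[R]_n).

(** Keeping the handle explicit turns the nested minima defining theta into one joint minimum over
    pairs [(U, c)]. *)
Definition handle_value d (U : 'I_n -> 'cV[R]_d) (c : 'cV[R]_d) : R :=
  \big[Num.max/0]_(i < n) (dotp c (U i)) ^- 2.

Definition admissible_handle d (U : 'I_n -> 'cV[R]_d) (c : 'cV[R]_d) : Prop :=
  unit_vector c /\ forall i, dotp c (U i) != 0.

Lemma gram_entry d (W : 'M[R]_(d, n)) i j :
  (W^T *m W) i j = dotp (col i W) (col j W).
Proof. by rewrite dotpE mxE; apply: eq_bigr => k _; rewrite !mxE. Qed.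

Lemma tr_mulmx_entry d (W : 'M[R]_(d, n)) c i : (W^T *m c) i 0 = dotp c (col i W).
Proof. by rewrite dotpC dotpE mxE; apply: eq_bigr => k _; rewrite !mxE. Qed.

Lemma Fval_dotp M x y : psd M -> x = M *m y ->
  Fval M x = dotp y x * max_ratio M x.
Proof.
move=> psdM xE; rewrite /Fval; congr (_ * _).
by rewrite xE psd_inverse_quad.
Qed.

Lemma Fval_le_handle_value d (U : 'I_n -> 'cV[R]_d) c :
  orthonormal_rep e U -> admissible_handle U c ->
  exists2 p, graph_pairs e p & Fval p.1 p.2 <= handle_value U c.
Proof.
move=> [U1 U0] [c1 cU].
pose W : 'M[R]_(d, n) := \matrix_(k, i) U i k 0.
have colW i : col i W = U i by apply/matrixP => k l; rewrite !mxE ord1.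
have [y xE] := normal_equation W c.
have psdM := gram_psd W.
exists (W^T *m W, W^T *m c).
  split=> //=.
  - by move=> i j ij eij; rewrite gram_entry !colW U0.
  - by exists y.
  - by move=> i; rewrite tr_mulmx_entry colW.
rewrite /= (Fval_dotp psdM xE).
have -> : max_ratio (W^T *m W) (W^T *m c) = handle_value U c.
  apply: eq_bigr => i _.
  by rewrite gram_entry tr_mulmx_entry colW U1 div1r.
(* What remains is [dotp y x <= 1]. This number is the squared norm of [W *m y], the projection of
   the unit vector [c], and the residual [c - W *m y] has nonnegative squared norm. *)
rewrite ler_piMl ?/handle_value ?bigmax_ge_id //.
have WyE : dotp (W *m y) c = dotp y (W^T *m c).
  by rewrite dotp_mulmx trmxK.
have WyWy : dotp (W *m y) (W *m y) = dotp y (W^T *m c).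
  by rewrite xE -mulmxA [RHS]dotp_mulmx trmxK.
have := dotp_ge0 (c - W *m y).
rewrite dotpBl !dotpBr c1 (dotpC c) WyWy WyE; lra.
Qed.

Section Pair.
Context (M : 'M[R]_n) (x : 'cV[R]_n).
Hypothesis Mx : graph_pairs e (M, x).

(** A zero diagonal entry would annihilate the [i]-th column of the Gram factor, hence also the
    coordinate [x i 0]. *)
Lemma diag_gt0 i : 0 < M i i.
Proof.
case: Mx => /= psdM _ [y xE] x0.
have [B ME] := psd_gram psdM.
rewrite ME gram_entry lt_def dotp_ge0 andbT; apply/eqP => /dotp_eq0 Bi.
by have := x0 i; rewrite xE ME -mulmxA tr_mulmx_entry Bi /dotp mulmx0 mxE eqxx.
Qed.

Lemma ratio_gt0 i : 0 < M i i / x i 0 ^+ 2.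
Proof.
case: Mx => _ _ _ x0.
by rewrite divr_gt0 ?diag_gt0 // exprn_even_gt0 //= x0.
Qed.

Lemma ratio_le i : M i i / x i 0 ^+ 2 <= max_ratio M x.
Proof. exact: (le_bigmax _ (fun u => M u u / x u 0 ^+ 2)). Qed.

Lemma handle_of_graph_pair : (0 < n)%N ->
  exists (U : 'I_n -> 'cV[R]_n) (c : 'cV[R]_n),
    [/\ orthonormal_rep e U, admissible_handle U c & handle_value U c = Fval M x].
Proof.
move=> n_gt0; case: Mx => /= psdM M0 [y xE] x0.
have [B ME] := psd_gram psdM.
pose q := dotp y (M *m y); pose s := Num.sqrt q.
pose m i := Num.sqrt (M i i).
have qE : q = dotp (B *m y) (B *m y).
  by rewrite /q {1}ME -mulmxA dotp_mulmx trmxK.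
have m2 i : m i ^+ 2 = M i i by rewrite sqr_sqrtr // ltW // diag_gt0.
have m0 i : m i != 0 by rewrite gt_eqF // sqrtr_gt0 diag_gt0.
have xB i : x i 0 = dotp (B *m y) (col i B).
  by rewrite -tr_mulmx_entry mulmxA -ME -xE.
(* The vector [B *m y] can be normalized because some vertex exists and [x] does not vanish
   there. *)
have q_gt0 : 0 < q.
  rewrite lt_def /q psd_dotp // andbT -/q; apply/eqP => q0.
  have By0 : B *m y = 0 by apply: dotp_eq0; rewrite -qE.
  by have := x0 (Ordinal n_gt0); rewrite xB By0 /dotp trmx0 mul0mx mxE eqxx.
have s2 : s ^+ 2 = q by rewrite sqr_sqrtr // ltW.
have s0 : s != 0 by rewrite gt_eqF // sqrtr_gt0.
exists (fun i => (m i)^-1 *: col i B), (s^-1 *: (B *m y)).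
have cU i : dotp (s^-1 *: (B *m y)) ((m i)^-1 *: col i B)
    = x i 0 / (s * m i).
  by rewrite dotpZl dotpZr -xB; field; rewrite s0 m0.
split.
- split=> [i | i j ij eij].
    rewrite /unit_vector dotpZl dotpZr -gram_entry -ME -m2; field; exact: m0.
  by rewrite dotpZl dotpZr -gram_entry -ME M0 // !mulr0.
- split=> [|i]; last by rewrite cU mulf_neq0 ?invr_eq0 ?mulf_neq0 ?x0 ?s0 ?m0.
  by rewrite /unit_vector dotpZl dotpZr -qE -s2; field.
rewrite (Fval_dotp psdM xE) {1}xE -/q /max_ratio.
(* Multiplication by [q > 0] commutes with the maximum and fixes its starting value [0]. *)
rewrite (big_morph (fun z => q * z) (id1 := 0) (op1 := Num.max)).
- apply: eq_bigr => i _; rewrite cU -s2 -m2; field.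
  by rewrite s0 m0 x0.
- by move=> z t; rewrite maxr_pMr // ltW.
- by rewrite mulr0.
Qed.

(** * The bound [|C| <= F(M, x)] and its equality case *)

Section IndependentSet.
Context (C : {set 'I_n}).
Let w : 'cV[R]_n := \col_u (if u \in C then (x u 0)^-1 else 0).

Lemma dotp_indicator (z : 'cV[R]_n) :
  dotp w z = \sum_(u in C) z u 0 / x u 0.
Proof.
rewrite dotpE [RHS]big_mkcond /=; apply: eq_bigr => u _; rewrite mxE.
by case: ifP => _; rewrite ?mul0r // mulrC.
Qed.

Lemma mulmx_indicator v : (M *m w) v 0 = \sum_(u in C) M v u * (x u 0)^-1.
Proof.
rewrite mxE [RHS]big_mkcond /=; apply: eq_bigr => u _; rewrite mxE.
by case: ifP => _; rewrite ?mulr0.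
Qed.

Hypothesis indC : independent e C.

Lemma independent_offdiag u v : u \in C -> v \in C -> u != v -> M u v = 0.
Proof.
move=> uC vC uv; case: Mx => /= _ -> //.
by move/forall_inP: indC => /(_ u uC)/forall_inP /(_ v vC).
Qed.

Lemma mulmx_indicator_in v : v \in C -> (M *m w) v 0 = M v v / x v 0.
Proof.
move=> vC; rewrite mulmx_indicator (bigD1 v) //= big1 ?addr0 // => u /andP[uC uv].
by rewrite independent_offdiag ?mul0r // eq_sym.
Qed.

Lemma dotp_indicator_quad :
  dotp w (M *m w) = \sum_(u in C) M u u / x u 0 ^+ 2.
Proof.
rewrite dotp_indicator; apply: eq_bigr => u uC.
by rewrite mulmx_indicator_in // -mulrA -invfM.
Qed.

Lemma dotp_indicator_self : dotp w x = #|C|%:R.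
Proof.
case: Mx => _ _ _ x0.
rewrite dotp_indicator (eq_bigr (fun=> 1)) ?sumr_const //.
by move=> u _; rewrite divff ?x0.
Qed.

Lemma sum_ratio_le :
  \sum_(u in C) M u u / x u 0 ^+ 2 <= #|C|%:R * max_ratio M x.
Proof.
rewrite mulr_natl -sumr_const; apply: ler_sum => u _; exact: ratio_le.
Qed.

(** Expanding the form, the cross terms contribute [-2 |C|]. One copy of [|C|] is paired with [F]
    and the other with the normalized sum of ratios: [F - |C|] is thus a sum of two nonnegative
    gaps. *)
Lemma indicator_gap y : x = M *m y -> 0 < max_ratio M x ->
  let K := max_ratio M x in
  let z := y - K^-1 *: w in
  K * dotp z (M *m z) = Fval M x - #|C|%:R
    - (#|C|%:R - K^-1 * \sum_(u in C) M u u / x u 0 ^+ 2).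
Proof.
move=> xE K_gt0 K z; have [/= psdM _ _ _] := Mx; have [/= MT _] := psdM.
rewrite /z mulmxBr -scalemxAr dotpBl !dotpBr !dotpZl !dotpZr dotp_indicator_quad.
rewrite -xE dotp_indicator_self dotp_mulmx MT -xE (dotpC x w) dotp_indicator_self.
rewrite (Fval_dotp psdM xE) -/K; field.
by rewrite gt_eqF.
Qed.

Lemma card_le_Fval : #|C|%:R <= Fval M x.
Proof.
have [[y /= xE] psdM] : in_column_space M x /\ psd M by case: Mx.
have K_ge0 : 0 <= max_ratio M x by exact: bigmax_ge_id.
have F_ge0 : 0 <= Fval M x.
  by rewrite (Fval_dotp psdM xE) mulr_ge0 // xE psd_dotp.
(* A vertex of [C] is what makes the maximal ratio positive; for empty [C] the bound is [0 <= F]. *)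
have [->|[u uC]] := set_0Vmem C; first by rewrite cards0.
have K_gt0 : 0 < max_ratio M x := lt_le_trans (ratio_gt0 u) (ratio_le u).
have /= := indicator_gap xE K_gt0; set z := y - _ => gap.
have : 0 <= max_ratio M x * dotp z (M *m z) by rewrite mulr_ge0 // psd_dotp.
have := sum_ratio_le; rewrite -ler_pdivrMr // mulrC gap; lra.
Qed.

(** Both gaps of [indicator_gap] must vanish: the first conclusion comes from the sum of ratios, the
    second from the form at [z]. *)
Lemma card_eq_Fval : #|C|%:R = Fval M x ->
  (forall v, v \in C -> M v v / x v 0 ^+ 2 = max_ratio M x) /\
  (forall v, max_ratio M x * x v 0 = (M *m w) v 0).
Proof.
move=> CF; have [/= psdM _ [y /= xE] _] := Mx.
(* All ratios are positive, so a nonpositive maximum means that there are no vertices. *)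
have [K0|K_gt0] := leP (max_ratio M x) 0.
  have noV (v : 'I_n) : False.
    by have := lt_le_trans (ratio_gt0 v) (ratio_le v); rewrite ltNge K0.
  by split=> v; case: (noV v).
have /= := indicator_gap xE K_gt0; set z := y - _ => gap.
have z_ge0 : 0 <= dotp z (M *m z) by rewrite psd_dotp.
have sum_le : (max_ratio M x)^-1 * (\sum_(u in C) M u u / x u 0 ^+ 2) <= #|C|%:R.
  by rewrite mulrC ler_pdivrMr // sum_ratio_le.
have Kz_ge0 := mulr_ge0 (ltW K_gt0) z_ge0.
split=> [v vC|v].
  have : \sum_(u in C) (max_ratio M x - M u u / x u 0 ^+ 2) = 0.
    rewrite sumrB sumr_const -[_ *+ _]mulr_natl.
    have -> : \sum_(u in C) M u u / x u 0 ^+ 2 = #|C|%:R * max_ratio M x.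
      apply/eqP; rewrite eq_le sum_ratio_le -ler_pdivlMr // mulrC; lra.
    by rewrite subrr.
  move/psumr_eq0P => h; apply/eqP; rewrite eq_sym -subr_eq0 h //.
  by move=> u _; rewrite subr_ge0 ratio_le.
have : dotp z (M *m z) = 0.
  apply: (mulfI (lt0r_neq0 K_gt0)); rewrite mulr0; lra.
(* A vector on which a positive semidefinite form vanishes lies in the kernel of the matrix. *)
have [B ME] := psd_gram psdM.
rewrite {1}ME -mulmxA dotp_mulmx trmxK => /dotp_eq0 Bz0.
have : M *m z = 0 by rewrite ME -mulmxA Bz0 mulmx0.
rewrite /z mulmxBr -xE -scalemxAr => /subr0_eq/matrixP/(_ v 0) ->.
by rewrite mxE mulrA divff ?mul1r // gt_eqF.
Qed.

(** On [C], independence reduces [(M *m w) v 0] to [M v v / x v 0], so the two conditions together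
    say [M *m w = K *: x] with [K] the maximal ratio. For nonzero [K], [K^-1 *: w] is then a
    preimage of [x], and it gives [F] the value [|C|]. *)
Lemma Fval_le_card :
  (forall v, v \in C -> M v v / x v 0 ^+ 2 = max_ratio M x) ->
  (forall v, v \notin C ->
     max_ratio M x * x v 0 = \sum_(u in C) M v u * (x u 0)^-1) ->
  Fval M x <= #|C|%:R.
Proof.
move=> inC outC; have [/= psdM _ _ x0] := Mx.
have MwE : M *m w = max_ratio M x *: x.
  apply/matrixP => v j; rewrite ord1 [RHS]mxE; have [vC|vC] := boolP (v \in C).
    by rewrite mulmx_indicator_in // -(inC v) //; field; exact: x0.
  by rewrite mulmx_indicator outC.
have [K0|K0] := eqVneq (max_ratio M x) 0; first by rewrite /Fval K0 mulr0.
have xE : x = M *m ((max_ratio M x)^-1 *: w).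
  by rewrite -scalemxAr MwE scalerA mulVf // scale1r.
rewrite (Fval_dotp psdM xE) dotpZl dotp_indicator_self.
by rewrite mulrAC mulVf // mul1r.
Qed.

End IndependentSet.
End Pair.
End GraphPairs.

(** * Compactness and continuity tools *)

Section Attainment.
Context (R : realType).

(* The hypothesis [f i v <= 1] only serves to make [1] a neutral starting value
   for the iterated minimum. *)
Lemma compact_minimax k n (A : set 'rV[R]_k) (f : 'I_n -> 'rV[R]_k -> R) :
  compact A -> (forall i, continuous (f i)) ->
  (forall i v, A v -> f i v <= 1) ->
  (exists2 v, A v & forall i, 0 < f i v) ->
  exists p, [/\ A p, forall i, 0 < f i p &
    forall v, A v -> (forall i, 0 < f i v) ->
      \big[Num.max/0]_i (f i p)^-1 <= \big[Num.max/0]_i (f i v)^-1].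
Proof.
move=> cptA cf f_le1 [v0 Av0 fv0].
(* Minimizing the largest reciprocal amounts to maximizing the smallest [f i], which stays
   continuous where some [f i] vanishes. *)
pose g v := \big[Num.min/1]_i f i v.
have cg : continuous g.
  apply: continuous_big => [|i _]; last exact: cf.
  exact: min_continuous.
have [p Ap gp] : exists2 p, p \in A & forall v, v \in A -> g v <= g p.
  apply: compact_EVT_max => //; first by exists v0.
  exact: continuous_subspaceT.
have g_gt0 v : (forall i, 0 < f i v) -> 0 < g v.
  by move=> fv; rewrite /g; apply: lt_bigmin.
have gf i v : g v <= f i v by apply: bigmin_le.
exists p; split=> [|i|v Av fv]; first by rewrite inE in Ap.
  by apply: lt_le_trans (gf i p); apply: lt_le_trans (gp v0 _); rewrite ?g_gt0 ?inE.
apply: bigmax_le => [|i _]; first exact: bigmax_ge_id.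
set t := \big[_/_]_i _.
have ft j : (f j v)^-1 <= t by exact: (le_bigmax _ (fun j => (f j v)^-1)).
have t_gt0 : 0 < t by apply: lt_le_trans (ft i); rewrite invr_gt0.
have tg : t^-1 <= g v.
  have tf j : t^-1 <= f j v by rewrite -[leRHS]invrK lef_pV2 ?posrE ?invr_gt0.
  by apply: le_bigmin => // ; apply: le_trans (tf i) (f_le1 i v Av).
have gpv : g v <= g p by apply: gp; rewrite inE.
rewrite -[leRHS]invrK lef_pV2 ?posrE ?invr_gt0 //.
  exact: le_trans tg (le_trans gpv (gf i p)).
exact: lt_le_trans (g_gt0 _ fv) (le_trans gpv (gf i p)).
Qed.

(** Such a set is a closed part of a product of segments, which is compact by Tychonoff. *)
Lemma compact_unit_coord k (A : set 'rV[R]_k) :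
  closed A -> (forall v i, A v -> `|v 0 i| <= 1) -> compact A.
Proof.
move=> clA A1.
have cube := @rV_compact R k (fun=> `[-1, 1]%classic)
  (fun=> @segment_compact R (-1) 1).
apply: (subclosed_compact clA cube) => v Av i.
by rewrite /= in_itv /= -ler_norml A1.
Qed.

Lemma dotp_continuous k d (u v : 'rV[R]_k -> 'cV[R]_d) :
  (forall i, continuous (fun p => u p i 0)) ->
  (forall i, continuous (fun p => v p i 0)) ->
  continuous (fun p => dotp (u p) (v p)).
Proof.
move=> cu cv.
have -> : (fun p => dotp (u p) (v p)) = (fun p => \sum_i u p i 0 * v p i 0).
  by apply/funext => p; rewrite dotpE.
apply: continuous_big => [|i _]; first exact: add_continuous.
by move=> p; apply: continuousM; [exact: cu | exact: cv].
Qed.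

Lemma closed_eq_preimage k (g : 'rV[R]_k -> R) b :
  continuous g -> closed [set p | g p = b].
Proof.
move=> cg; apply: (@preimage_closed _ _ g [set b]) => [p _|]; first exact: cg.
exact: closed_eq.
Qed.

End Attainment.

(** * Attainment of the two minima defining theta *)

Section Optimum.
Context (R : realType) (n : nat).
Hypothesis n_gt0 : (0 < n)%N.

(* The vectors [(1, t, t^2, ...)] orthogonal to some [U i] correspond to the
   roots [t] of finitely many nonzero polynomials. *)
Lemma exists_handle d (U : 'I_n -> 'cV[R]_d) : (forall i, U i != 0) ->
  exists c, admissible_handle U c.
Proof.
move=> U0; pose p i := \sum_(k < d) U i k 0 *: 'X^k.
have p0 i : p i != 0.
  apply: contra_neq (U0 i) => pi0; apply/matrixP => k j; rewrite ord1 mxE.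
  have /(congr1 (fun q : {poly R} => q`_k)) := pi0; rewrite coef0 coef_sum.
  rewrite (bigD1 k) //= big1 => [|l lk]; rewrite coefZ coefXn ?eqxx ?mulr1 ?addr0 //.
  by rewrite eq_sym (negPf (lk : l != k :> nat)) mulr0.
pose P := \prod_i p i.
have P0 : P != 0 by apply/prodf_neq0 => i _.
have [t Pt] : exists t : R, ~~ root P t.
  apply: contrapT => /forallNP roots.
  (* The first [size P] natural numbers would be more distinct roots than [P] can have. *)
  pose rs : seq R := [seq k%:R | k <- iota 0 (size P)].
  have rs_roots : all (root P) rs.
    by apply/allP => _ /mapP[k _ ->]; apply: contrapT => /negP; exact: roots.
  have rs_uniq : uniq rs.
    by rewrite map_inj_uniq ?iota_uniq // => i j /eqP; rewrite eqr_nat => /eqP.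
  by have := max_poly_roots P0 rs_roots rs_uniq; rewrite size_map size_iota ltnn.
pose c : 'cV[R]_d := \col_k t ^+ k.
have cU i : dotp c (U i) != 0.
  have : ~~ root (p i) t.
    by move: Pt; rewrite /root horner_prod prodf_seq_neq0 => /allP/(_ i); apply;
       rewrite mem_index_enum.
  apply: contra => /eqP ci; apply/rootP.
  rewrite horner_sum -[RHS]ci dotpE; apply: eq_bigr => k _.
  by rewrite hornerZ hornerXn !mxE mulrC.
have c_gt0 : 0 < dotp c c.
  rewrite lt_def dotp_ge0 andbT; apply/eqP => /dotp_eq0 c0.
  by have := cU (Ordinal n_gt0); rewrite c0 /dotp trmx0 mul0mx mxE eqxx.
have s0 : Num.sqrt (dotp c c) != 0 by rewrite gt_eqF // sqrtr_gt0.
exists ((Num.sqrt (dotp c c))^-1 *: c); split=> [|i]; last first.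
  by rewrite dotpZl mulf_neq0 // invr_eq0.
rewrite /unit_vector dotpZl dotpZr -[X in _ * (_ * X)]sqr_sqrtr ?dotp_ge0 //.
by field.
Qed.

Lemma optimal_handle d (U : 'I_n -> 'cV[R]_d) : (forall i, unit_vector (U i)) ->
  exists2 c, admissible_handle U c &
    forall c', admissible_handle U c' -> handle_value U c <= handle_value U c'.
Proof.
move=> U1; pose A : set 'rV[R]_d := [set v | dotp v^T v^T = 1].
(* Squares turn nonvanishing into positivity and are at most [1] on the sphere, as [compact_minimax]
   requires. *)
pose f i (v : 'rV[R]_d) := dotp v^T (U i) ^+ 2.
have ctr i : continuous (fun v : 'rV[R]_d => v^T i 0).
  have -> : (fun v : 'rV[R]_d => v^T i 0) = (fun v => v 0 i).
    by apply/funext => v; rewrite mxE.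
  exact: coord_continuous.
have [c0 [c01 c0U]] : exists c, admissible_handle U c.
  apply: exists_handle => i; apply/eqP => Ui; have := U1 i.
  by rewrite Ui /unit_vector /dotp mulmx0 mxE => /esym/eqP; rewrite oner_eq0.
have [] := @compact_minimax R d n A f.
- apply: compact_unit_coord => [|v i v1]; last first.
    by have := unit_vector_coord i v1; rewrite mxE.
  by apply: closed_eq_preimage; exact: dotp_continuous.
- move=> i v; apply: (@continuousM _ _ (fun v : 'rV[R]_d => dotp v^T (U i)));
  by apply: dotp_continuous => // k; exact: cst_continuous.
- by move=> i v v1; exact: dotp_unit_sqr_le1.
- exists c0^T; first by rewrite /A /= trmxK.
  by move=> i; rewrite /f trmxK exprn_even_gt0 //= c0U.
move=> p [p1 pU pmin]; exists p^T.
  by split=> // i; have := pU i; rewrite /f exprn_even_gt0.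
move=> c [c1 cU]; rewrite /handle_value -[c]trmxK; apply: pmin.
  by rewrite /A /= trmxK.
by move=> i; rewrite /f trmxK exprn_even_gt0 //= cU.
Qed.

(** Factoring the Gram matrix by a square matrix moves [m] vectors isometrically into dimension [m],
    whatever [d] was. *)
Lemma gram_family d m (F : 'I_m -> 'cV[R]_d) :
  exists B : 'M[R]_m, forall i j, dotp (col i B) (col j B) = dotp (F i) (F j).
Proof.
pose W : 'M[R]_(d, m) := \matrix_(k, i) F i k 0.
have colW i : col i W = F i by apply/matrixP => k l; rewrite !mxE ord1.
have [B BE] := psd_gram (gram_psd W).
by exists B => i j; rewrite -gram_entry -BE gram_entry !colW.
Qed.

Lemma optimal_representation (e : rel 'I_n) :
  exists d (U : 'I_n -> 'cV[R]_d) c, [/\ orthonormal_rep e U,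
    admissible_handle U c &
    forall d' (U' : 'I_n -> 'cV[R]_d') c', orthonormal_rep e U' ->
      admissible_handle U' c' -> handle_value U c <= handle_value U' c'].
Proof.
(* A row [v] packs a square matrix of order [n.+1]: column [ord0] is the handle and column
   [lift ord0 i] represents vertex [i]. *)
pose W (v : 'rV[R]_(n.+1 * n.+1)) (i : 'I_n.+1) := col i (vec_mx v).
pose ortho (i j : 'I_n.+1) := exists k l : 'I_n,
  [/\ i = lift ord0 k, j = lift ord0 l, k != l & ~~ e k l].
pose A : set 'rV[R]_(n.+1 * n.+1) :=
  [set v | (forall i, unit_vector (W v i)) /\
           (forall i j, ortho i j -> dotp (W v i) (W v j) = 0)].
pose f i v := dotp (W v ord0) (W v (lift ord0 i)) ^+ 2.
have Wcont i j : continuous (fun v => dotp (W v i) (W v j)).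
  apply: dotp_continuous => k.
    have -> : (fun v => W v i k 0) = (fun v => v 0 (mxvec_index k i)).
      by apply/funext => v; rewrite !mxE.
    exact: coord_continuous.
  have -> : (fun v => W v j k 0) = (fun v => v 0 (mxvec_index k j)).
    by apply/funext => v; rewrite !mxE.
  exact: coord_continuous.
have transfer d (U : 'I_n -> 'cV[R]_d) c :
    orthonormal_rep e U -> admissible_handle U c ->
    exists v, [/\ A v, forall i, 0 < f i v
      & handle_value U c = \big[Num.max/0]_i (f i v)^-1].
  move=> [U1 U0] [c1 cU].
  have [B BE] := gram_family (fun i => oapp U c (unlift ord0 i)).
  have WB i : W (mxvec B) i = col i B by rewrite /W mxvecK.
  have fE i : f i (mxvec B) = dotp c (U i) ^+ 2.
    by rewrite /f !WB BE unlift_none liftK.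
  exists (mxvec B); split.
  - split=> [i|_ _ [i [j [-> -> ij eij]]]]; last by rewrite !WB BE !liftK U0.
    by rewrite /unit_vector WB BE; case: unliftP => [j _|_] /=; [exact: U1|].
  - by move=> i; rewrite fE exprn_even_gt0 //= cU.
  - by apply: eq_bigr => i _; rewrite fE.
(* The standard basis is an orthonormal representation of every graph; with a handle, it gives a
   feasible point of [A]. *)
have [U0 U0rep] : exists U : 'I_n -> 'cV[R]_n, orthonormal_rep e U.
  have dE i j : dotp (delta_mx i 0 : 'cV[R]_n) (delta_mx j 0) = (i == j)%:R.
    rewrite /dotp trmx_delta mul_delta_mx_cond.
    by case: eqP => _; rewrite ?mulr1n ?mulr0n mxE.
  exists (fun i => delta_mx i 0); split=> [i|i j /negPf ij _].
    by rewrite /unit_vector dE eqxx.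
  by rewrite dE ij.
have [c0 Uc0 _] := optimal_handle U0rep.1.
have [v0 [Av0 fv0 _]] := transfer _ _ _ U0rep Uc0.
have [] := @compact_minimax R _ n A f.
- apply: compact_unit_coord => [|v k [v1 _]]; last first.
    case/mxvec_indexP: k => k i.
    by have := unit_vector_coord k (v1 i); rewrite !mxE.
  (* Each triple [(i, j, b)] encodes one constraint [dotp (W v i) (W v j) = b], so [A] is an
     intersection of closed level sets. *)
  pose Q : set ('I_n.+1 * 'I_n.+1 * R) :=
    [set q | (q.1.1 = q.1.2 /\ q.2 = 1) \/ (ortho q.1.1 q.1.2 /\ q.2 = 0)].
  have -> : A = \bigcap_(q in Q) [set v | dotp (W v q.1.1) (W v q.1.2) = q.2].
    apply/seteqP; split=> [v [v1 v0'] [[i j] b]|v vQ].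
    + by rewrite /Q /= => -[[<- ->]|[ij ->]]; [exact: v1 | exact: v0'].
    + split=> [i|i j ij]; first by apply: (vQ (i, i, 1)); left.
      by apply: (vQ (i, j, 0)); right.
  by apply: closed_bigI => q _; exact: closed_eq_preimage.
- by move=> i v; apply: (@continuousM _ _ (fun v => dotp (W v ord0) (W v (lift ord0 i))));
  exact: Wcont.
- by move=> i v [v1 _]; exact: dotp_unit_sqr_le1.
- by exists v0.
move=> p [[p1 p0] pf pmin].
exists n.+1, (fun i => W p (lift ord0 i)), (W p ord0); split.
- split=> [i|i j ij eij]; first exact: p1.
  by apply: p0; exists i, j.
- by split=> [|i]; [exact: p1 | have := pf i; rewrite /f exprn_even_gt0].
- move=> d U c Urep Uc; have [v [Av fv ->]] := transfer _ _ _ Urep Uc.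
  exact: pmin.
Qed.

Lemma is_minimum_eq (B : set R) m : is_minimum B m -> minimum B = m.
Proof.
move=> [Bm lm]; rewrite /minimum.
have [Bm' lm'] : is_minimum B (xget 0 (is_minimum B)).
  by apply: (@xgetPex _ 0 (is_minimum B)); exists m.
by apply/eqP; rewrite eq_le lm // lm'.
Qed.

Lemma rep_value_optimal d (U : 'I_n -> 'cV[R]_d) c : admissible_handle U c ->
  (forall c', admissible_handle U c' -> handle_value U c <= handle_value U c') ->
  rep_value U = handle_value U c.
Proof.
move=> [c1 cU] cmin; apply: is_minimum_eq; split.
  by exists c.
by move=> _ [c' [c'1 c'U ->]]; apply: cmin.
Qed.

(** A jointly optimal pair [(U, c)] makes [c] optimal for [U] and [U] optimal among representations,
    so the nested minima exist and equal the joint one. *)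
Lemma lovasz_theta_optimal (e : rel 'I_n) :
  exists d (U : 'I_n -> 'cV[R]_d) c, [/\ orthonormal_rep e U,
    admissible_handle U c,
    lovasz_theta R e = handle_value U c &
    forall d' (U' : 'I_n -> 'cV[R]_d') c', orthonormal_rep e U' ->
      admissible_handle U' c' -> lovasz_theta R e <= handle_value U' c'].
Proof.
have [d [U [c [Urep Uc Umin]]]] := optimal_representation e.
have thetaE : lovasz_theta R e = handle_value U c.
  apply: is_minimum_eq; split.
    exists d, U; split=> //; symmetry; apply: rep_value_optimal => // c' Uc'.
    exact: Umin.
  move=> _ [d' [U' [U'rep ->]]].
  have [c' U'c' c'min] := optimal_handle U'rep.1.
  by rewrite (rep_value_optimal U'c' c'min) Umin.
by exists d, U, c; split=> // *; rewrite thetaE Umin.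
Qed.

End Optimum.

(** * Theta as the minimum of [F], and the case of equality with the independence number *)

Lemma lovasz_theta_is_minimum (R : realType) n (e : rel 'I_n) :
  is_minimum [set Fval p.1 p.2 | p in graph_pairs e] (lovasz_theta R e).
Proof.
(* Without vertices every maximum is empty, and both [F] and theta are [0]; [rep_value] is [0] even
   in dimension [0], where no unit vector exists and the default value applies. *)
have [n0|n_gt0] := posnP n.
  subst n.
  have max0 (F : 'I_0 -> R) : \big[Num.max/0]_i F i = 0 by rewrite big_ord0.
  have theta0 : lovasz_theta R e = 0.
    have rep0 d (U : 'I_0 -> 'cV[R]_d) : rep_value U = 0.
      rewrite /rep_value /minimum; case: xgetP => [m _ [[c [_ _ ->]] _]|//].
      exact: max0.
    apply: is_minimum_eq; split.
      exists 0%N, (fun=> 0); split; last by rewrite rep0.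
      by split=> -[].
    by move=> _ [d [U [_ ->]]]; rewrite rep0.
  have F0 (M : 'M[R]_0) x : Fval M x = 0 by rewrite /Fval /max_ratio max0 mulr0.
  rewrite theta0; split; last by move=> _ [p _ <-]; rewrite F0.
  exists (0, 0); last exact: F0.
  split=> /=; [|by case|by exists 0; rewrite mulmx0|by case].
  by split=> [|y]; rewrite ?trmx0 // mulmx0 mul0mx mxE.
have [d [U [c [Urep Uc thetaE thetamin]]]] := lovasz_theta_optimal R n_gt0 e.
have lb M x : graph_pairs e (M, x) -> lovasz_theta R e <= Fval M x.
  move=> Mx; have [U' [c' [U'rep U'c' <-]]] := handle_of_graph_pair Mx n_gt0.
  exact: thetamin.
split; last by move=> _ [[M x] Mx <-]; exact: lb.
have [[M x] Mx F_le] := Fval_le_handle_value Urep Uc.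
by exists (M, x) => //; apply/eqP; rewrite eq_le lb // thetaE F_le.
Qed.

Theorem theorem4p1 (R : realType) (n : nat) (e : rel 'I_n)
    (e_sym : symmetric e) (e_irr : irreflexive e) :
  [/\ (independence_number e)%:R <= lovasz_theta R e,
      is_minimum [set Fval p.1 p.2 | p in graph_pairs e] (lovasz_theta R e)
    & (independence_number e)%:R = lovasz_theta R e <->
      exists (M : 'M[R]_n) (x : 'cV[R]_n) (C : {set 'I_n}),
        [/\ graph_pairs e (M, x),
            independent e C,
            is_diag_mx (principal_submx M C),
            forall v, v \in C -> M v v / x v 0 ^+ 2 = max_ratio M x
          & forall v, v \notin C ->
              max_ratio M x * x v 0 = \sum_(u in C) M v u * (x u 0)^-1]].
Proof.
have theta_min := lovasz_theta_is_minimum R e.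
have [[[M x] /= Mx FE] F_ge] := theta_min.
have [C indC alphaE] : {C | independent e C & independence_number e = #|C|}.
  (* A maximum is attained only over a nonempty family; the empty set is independent. *)
  apply: eq_bigmax_cond; apply/card_gt0P; exists finset.set0.
  by apply/forall_inP => u; rewrite inE.
have alpha_le : (independence_number e)%:R <= lovasz_theta R e.
  by rewrite alphaE -FE; exact: (card_le_Fval Mx indC).
split=> //; split=> [alpha_theta | [M' [x' [C' [Mx' indC' _ inC outC]]]]].
  (* A minimizer of [F] and a maximum independent set meet the bound [|C| <= F] with equality. *)
  have /(card_eq_Fval Mx indC)[inC outC] : #|C|%:R = Fval M x.
    by rewrite FE -alpha_theta alphaE.
  exists M, x, C; split=> // [|v _].
    apply/is_diag_mxP => i j ij; rewrite mxE.
    by apply: (independent_offdiag Mx indC); rewrite ?enum_valP // (inj_eq enum_val_inj).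
  by rewrite outC mulmx_indicator.
apply/eqP; rewrite eq_le alpha_le /=.
(* The chain is theta [<= F(M', x') <= |C'| <=] independence number. *)
apply: (@le_trans _ _ (Fval M' x')); first by apply: F_ge; exists (M', x').
apply: le_trans (Fval_le_card Mx' indC' inC outC) _.
by rewrite ler_nat; apply: leq_bigmax_cond.
Qed.
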